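(* Let $H$ be a real Hilbert space with inner product $(\cdot,\cdot)$ and norm $\|\cdot\|$, let $F:H\to H$ be a (possibly nonlinear) Fréchet differentiable map, let $u_0\in H$, $R>0$, and $B:=\{u\in H:\ \|u-u_0\|\le R\}$. Let $\Phi(t,u)$ be an $H$-valued map, defined for $t\ge 0$ and $u\in B$, which is continuous in the norm of $H$ and Lipschitz with respect to $u$ in $B$. Let $g_1,g_2$ be positive functions on $\mathbb{R}_+=[0,\infty)$, with $g_2$ continuous and $g_1\in L^1_{loc}(\mathbb{R}_+)$, such that for all $t\ge 0$ and all $u\in B$ $$(F'(u)\Phi(t,u),F(u))\le -g_1(t)\|F(u)\|^2,\qquad \|\Phi(t,u)\|\le g_2(t)\|F(u)\|.$$ Assume $$\int_0^\infty g_1(t)\,dt=+\infty,\qquad G(t):=g_2(t)\exp\Big(-\int_0^t g_1(s)\,ds\Big)\in L^1(\mathbb{R}_+),\qquad \|F(u_0)\|\int_0^\infty G(t)\,dt\le R.$$ Then the Cauchy problem $$\dot u=\Phi(t,u),\qquad u(0)=u_0,$$ has a global solution $u(t)$ (that is, a solution defined for all $t\ge 0$), $u(t)\in B$ for all $t\ge 0$, the strong limit $y:=\lim_{t\to\infty}u(t)$ exists, $F(y)=0$, and for all $t\ge 0$ $$\|u(t)-y\|\le \|F(u_0)\|\int_t^\infty G(x)\,dx,\qquad \|F(u(t))\|\le \|F(u_0)\|\exp\Big(-\int_0^t g_1(x)\,dx\Big).$$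
   Context: $F'(u)$ denotes the Fréchet derivative of $F$ at $u$, $\dot u:=du/dt$, and a strong limit is a limit in the norm of $H$. *)

(* Defs.v *)
From HB Require Import structures.
From mathcomp Require Import all_boot all_order all_algebra sesquilinear.
From mathcomp Require Import all_classical all_reals all_analysis.

Set Implicit Arguments.
Unset Strict Implicit.
Unset Printing Implicit Defensive.

Import Order.TTheory GRing.Theory Num.Theory.
Import numFieldNormedType.Exports.

Local Open Scope classical_set_scope.
Local Open Scope ring_scope.

(* A real Hilbert space is a complete normed module over a realType together
   with a positive definite symmetric bilinear form ([idfun] replaces the
   complex conjugation of the Hermitian case) that induces its norm. *)
Definition induces_norm (R : realType) (H : completeNormedModType R)
    (dot : {dot H for idfun}) : Prop :=
  forall x : H, `|x| = Num.sqrt (dot x x).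

Definition cball (R : realType) (H : normedModType R) (c : H) (r : R) : set H :=
  [set u | `|u - c| <= r].

(* The library's [locally_integrable] only makes sense on open domains, whereas
   the half line [0, +oo[ contains its end point. *)
Definition L1loc_Rplus (R : realType) (g : R -> R) : Prop :=
  forall T : R, 0 <= T ->
    (@lebesgue_measure R).-integrable `[0, T] (EFin \o g).

Definition decay (R : realType) (g : R -> R) (t : R) : R :=
  expR (- \int[@lebesgue_measure R]_(s in `[0, t]) g s).

(* Functions of t >= 0 and u \in B are total functions of which only the values
   on that domain are constrained; continuity is joint in (t, u). *)
Definition continuous_Rplus_times (R : realType) (H : normedModType R)
    (B : set H) (Phi : R -> H -> H) : Prop :=
  {within [set z : R * H | 0 <= z.1 /\ B z.2],
     continuous (fun z : R * H => Phi z.1 z.2)}.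

(* The Lipschitz constant may depend on t, but is bounded on bounded time
   intervals; this includes the case of a constant independent of t. *)
Definition lipschitz_in_space (R : realType) (H : normedModType R)
    (B : set H) (Phi : R -> H -> H) : Prop :=
  forall T : R, 0 <= T ->
    exists L : R, forall t, 0 <= t <= T -> L.-lipschitz_B (Phi t).

(* The derivative is taken within [0, +oo[: it is the ordinary (two-sided)
   derivative for t > 0 and the right derivative at t = 0. *)
Definition global_solution (R : realType) (H : normedModType R)
    (Phi : R -> H -> H) (u0 : H) (u : R -> H) : Prop :=
  u 0 = u0 /\
  forall t : R, 0 <= t ->
    (s - t)^-1 *: (u s - u t) @[s --> within [set s : R | 0 <= s] t^']
      --> Phi t (u t).

(* Main.v *)
Require Import Defs.
From HB Require Import structures.
From mathcomp Require Import all_boot all_order all_algebra sesquilinear.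
From mathcomp Require Import all_classical all_reals all_analysis.
From mathcomp Require Import measurable_realfun ring lra.

(** Put [K := `|F u0|] and let [Gam t] be the integral of [G] over [[0, t]].

    The heart of the matter is an a priori estimate.  Along a solution [u] that
    stays in the ball, [psi := `|F (u t)| ^+ 2] has the derivative
    [2 * dot ('d F (u t) (Phi t (u t))) (F (u t)) <= - 2 * g1 t * psi], so that
    [`|F (u t)| <= K * decay g1 t].  Then [`|Phi t (u t)| <= K * G t], and
    integrating the velocity gives [`|u t - u s| <= K * (Gam t - Gam s)] for
    [s <= t].  As [G] is positive, [Gam t] is strictly below the integral of
    [G] over the half line, hence [`|u t - u0| < r]: in finite time the
    solution never reaches the boundary of the ball.  The same estimate makes
    [u] Cauchy at infinity; its limit [y] inherits the bound on [u t - y], and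
    [F y = 0] because [decay g1 t] tends to [0].

    Existence.  The solution is obtained for the field
    [Psi t x := Phi (Num.max t 0) (retract u0 r x)], where [retract] is the
    radial retraction onto the ball.  This field is defined on all of [H] and
    Lipschitz in [x], uniformly on bounded time intervals, so the Picard
    iteration converges for all times ([cauchy_problem]); as long as the
    solution stays in the ball it solves the original equation, and by the a
    priori estimate it never leaves it ([lt_of_no_exit]).

    Integration of vector-valued functions is replaced by two facts.  The mean
    value inequality [mean_value_inequality] reduces to the scalar case by
    taking the inner product with [v b - v a].  Primitives of continuous curves
    ([primitive_exists]) are limits of primitives of tent-function
    interpolations, because derivatives pass to locally uniform limits
    ([primitive_of_limit]); the same limit theorem turns the Picard iterates
    into a solution.

    The function [g1] is only locally integrable and [psi] only
    differentiable, so the inequality for [psi] cannot be integrated by the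
    fundamental theorem of calculus.  But [theta := - ln `|F (u t)|] is
    differentiable with [g1 <= theta'], and for nonnegative [g1] Fatou's lemma
    applied to the difference quotients of [theta] yields that the integral of
    [g1] is at most the increment of [theta] ([integral_le_increment]). *)

Set Implicit Arguments.
Unset Strict Implicit.
Unset Printing Implicit Defensive.

Import Order.TTheory GRing.Theory Num.Theory.
Import numFieldNormedType.Exports.

Local Open Scope classical_set_scope.
Local Open Scope ring_scope.

(** * Real inner products *)

Section InnerProduct.
Context (R : realType) (H : completeNormedModType R) (dot : {dot H for idfun}).
Hypothesis Hnorm : induces_norm dot.

Implicit Types x y z : H.

Lemma dotC x y : dot x y = dot y x.
Proof. by rewrite (hermC dot) expr0 mul1r. Qed.

Lemma dotDr x y z : dot x (y + z) = dot x y + dot x z.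
Proof. exact: linearDr. Qed.

Lemma dotDl x y z : dot (x + y) z = dot x z + dot y z.
Proof. by rewrite ![dot _ z]dotC dotDr. Qed.

Lemma dotBl x y z : dot (x - y) z = dot x z - dot y z.
Proof. exact: linearBl. Qed.

Lemma dotZl (a : R) x y : dot (a *: x) y = a * dot x y.
Proof. exact: linearZl_LR. Qed.

Lemma dotxx x : dot x x = `|x| ^+ 2.
Proof.
have [->|x0] := eqVneq x 0; first by rewrite linear0l normr0 expr0n.
by rewrite Hnorm sqr_sqrtr // ltW// neq0_dnorm_gt0.
Qed.

(** Polarization expresses the inner product through norms; boundedness and
    continuity of [dot] then follow from the properties of the norm. *)
Lemma dotE x y : dot x y = (`|x + y| ^+ 2 - `|x| ^+ 2 - `|y| ^+ 2) / 2.
Proof. by rewrite -!dotxx dotDl !dotDr (dotC y x); field. Qed.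

(** By polarization this is the triangle inequality for [x + y], squared. *)
Lemma dot_le_norm x y : dot x y <= `|x| * `|y|.
Proof.
rewrite dotE ler_pdivrMr//.
have := ler_normD x y; have := normr_ge0 (x + y); nra.
Qed.

Lemma cvg_dot (T : Type) (A : set_system T) {FA : Filter A}
    (f g : T -> H) (a b : H) :
  f @ A --> a -> g @ A --> b -> (fun i => dot (f i) (g i)) @ A --> dot a b.
Proof.
move=> fa gb; rewrite dotE; under eq_fun do rewrite dotE.
apply: cvgMl; apply: cvgB; [apply: cvgB|].
- by rewrite !expr2; apply: cvgM; apply: cvg_norm; exact: cvgD.
- by rewrite !expr2; apply: cvgM; apply: cvg_norm.
- by rewrite !expr2; apply: cvgM; apply: cvg_norm.
Qed.
End InnerProduct.

(** * Derivatives of curves and the mean value inequality *)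

Section MeanValue.
Context (R : realType) (H : completeNormedModType R) (dot : {dot H for idfun}).
Hypothesis Hnorm : induces_norm dot.

(** For curves the direction vector [1] of the general directional derivative
    can be dropped from the difference quotient. *)
Lemma is_deriveP (V : normedModType R) (v : R -> V) (t : R) (d : V) :
  is_derive t 1 v d <-> h^-1 *: (v (h + t) - v t) @[h --> 0^'] --> d.
Proof.
have E : (fun h => h^-1 *: ((v \o shift t) h%:A - v t)) =
         (fun h => h^-1 *: (v (h + t) - v t)).
  by apply/funext => h /=; rewrite [_%:A]mulr1.
split=> [[dv <-]|dv].
  by move: dv; rewrite /derive /derivable E.
split; first by apply/cvg_ex; exists d; rewrite E.
by rewrite /derive E; apply/cvg_lim => //.
Qed.

Lemma is_derive_continuous (V : normedModType R) (v : R -> V) (t : R) (d : V) :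
  is_derive t 1 v d -> {for t, continuous v}.
Proof.
by move=> [dv _]; apply: differentiable_continuous; apply/derivable1_diffP.
Qed.

Lemma is_derive_mull (c t : R) : is_derive t 1 (fun s : R => c * s) c.
Proof.
apply/is_deriveP; apply: cvg_near_cst; near=> h.
rewrite -mulrBr addrK /GRing.scale /= mulrCA mulVf ?mulr1//.
by near: h; exact: nbhs_dnbhs_neq.
Unshelve. all: by end_near. Qed.

Lemma is_derive_scalel (V : normedModType R) (p : R -> R) (dp : R) (c : V)
    (t : R) :
  is_derive t 1 p dp -> is_derive t 1 (fun s => p s *: c) (dp *: c).
Proof.
move=> /is_deriveP Dp; apply/is_deriveP.
under eq_fun do rewrite -scalerBl scalerA.
by apply: cvgZr_tmp; exact: Dp.
Qed.

Lemma is_derive_dot (v w : R -> H) (t : R) (dv dw : H) :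
  is_derive t 1 v dv -> is_derive t 1 w dw ->
  is_derive t 1 (fun s => dot (v s) (w s)) (dot dv (w t) + dot (v t) dw).
Proof.
move=> Dv Dw; apply/is_deriveP.
have cv : v (h + t) @[h --> 0^'] --> v t.
  have /is_derive_continuous/continuous_withinNshiftx := Dv.
  exact.
have -> : (fun h => h^-1 *: (dot (v (h + t)) (w (h + t)) - dot (v t) (w t))) =
   (fun h => dot (h^-1 *: (v (h + t) - v t)) (w t) +
             dot (v (h + t)) (h^-1 *: (w (h + t) - w t))).
  apply/funext => h; rewrite [dot (v (h + t)) (h^-1 *: _)]dotC !dotZl !dotBl.
  rewrite -mulrDr (dotC dot (w t)) (dotC dot (w (h + t))).
  by congr (_ * _); ring.
apply: cvgD; apply: (cvg_dot Hnorm) => //; try exact: cvg_cst.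
- exact/is_deriveP.
- exact/is_deriveP.
Qed.

Lemma within_continuous_dot (A : set R) (v : R -> H) (w : H) :
  {within A, continuous v} -> {within A, continuous (fun s => dot (v s) w)}.
Proof. by move=> cv t; apply: (cvg_dot Hnorm); [exact: cv|exact: cvg_cst]. Qed.

(** Comparison with a scalar function [phi] instead of a constant bound on the
    speed is what the integral bounds need: [phi] will be an exponential in the
    Picard iteration and an integral of [G] in the a priori estimate. *)
Lemma mean_value_inequality (v d : R -> H) (phi dphi : R -> R) (a b : R) :
  a <= b ->
  (forall t, a < t < b -> is_derive t 1 v (d t)) ->
  (forall t, a < t < b -> is_derive t 1 phi (dphi t)) ->
  {within `[a, b], continuous v} -> {within `[a, b], continuous phi} ->
  (forall t, a < t < b -> `|d t| <= dphi t) ->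
  `|v b - v a| <= phi b - phi a.
Proof.
move=> ab Dv Dphi cv cphi ddphi.
(* Pairing with a fixed vector reduces the claim to a scalar function whose
   derivative is nonpositive by Cauchy-Schwarz. *)
have key (w : H) : dot (v b) w - `|w| * phi b <= dot (v a) w - `|w| * phi a.
  pose p s := dot (v s) w - `|w| * phi s.
  have Dp t : a < t < b -> is_derive t 1 p (dot (d t) w - `|w| * dphi t).
    move=> tab; have D1 : is_derive t 1 (fun s => dot (v s) w) (dot (d t) w).
      have := is_derive_dot (Dv t tab) (is_derive_cst w t 1).
      by rewrite linear0r addr0.
    have D2 : is_derive t 1 (fun s => `|w| * phi s) (`|w| * dphi t).
      by apply: is_deriveZ; exact: Dphi.
    exact: is_deriveB.
  apply: (@ler0_derive1_le_cc _ p a b) => //.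
  - by move=> t; rewrite in_itv/= => tab; have [] := Dp t tab.
  - move=> t; rewrite in_itv/= => tab; rewrite derive1E; have [_ ->] := Dp t tab.
    rewrite subr_le0 (le_trans (dot_le_norm Hnorm _ _))// mulrC ler_wpM2l//.
    exact: ddphi.
  - apply: within_continuousB; first exact: within_continuous_dot.
    by move=> t; apply: cvgM; [exact: cvg_cst|exact: cphi].
  - by rewrite in_itv/= lexx ab.
  - by rewrite in_itv/= lexx ab.
(* The inequality [key] is void for [w = 0], so the case [v b = v a] relies on
   the monotonicity of [phi]. *)
have phiab : phi a <= phi b.
  apply: (@ger0_derive1_le_cc _ phi a b) => //.
  - by move=> t; rewrite in_itv/= => tab; have [] := Dphi t tab.
  - move=> t; rewrite in_itv/= => tab; rewrite derive1E.
    by have [_ ->] := Dphi t tab; exact: le_trans (ddphi t tab).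
  - by rewrite in_itv/= lexx ab.
  - by rewrite in_itv/= lexx ab.
have [->|vab] := eqVneq (v b - v a) 0; first by rewrite normr0 subr_ge0.
have := key (v b - v a); rewrite -subr_ge0 -normr_gt0 in vab *.
move=> k; rewrite -(ler_pM2l vab) -expr2 -(dotxx Hnorm) dotBl; lra.
Qed.
End MeanValue.

(** * Locally uniform limits of derivatives *)

Section Limit.
Context (R : realType) (H : completeNormedModType R) (dot : {dot H for idfun}).
Hypothesis Hnorm : induces_norm dot.

Lemma dist_between (a b s : R) :
  Num.min a b <= s <= Num.max a b -> `|s - a| <= `|b - a|.
Proof.
case: (lerP a b) => ab /andP[sa sb].
  by rewrite ger0_norm ?subr_ge0// lerD2r.
by rewrite ler0_norm ?subr_le0//; lra.
Qed.

(** The mean value inequality for [v s - s *: c]: a velocity close to [c] moves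
    the curve almost as uniform motion does. *)
Lemma derive_near_constant (v d : R -> H) (c : H) (e a b : R) :
  (forall t : R, is_derive t 1 v (d t)) ->
  (forall t, Num.min a b <= t <= Num.max a b -> `|d t - c| <= e) ->
  `|v b - v a - (b - a) *: c| <= e * `|b - a|.
Proof.
move=> Dv dc; wlog ab : a b dc / a <= b.
  move=> W; have [/W|ba] := leP a b; first exact.
  have -> : v b - v a - (b - a) *: c = - (v a - v b - (a - b) *: c).
    by rewrite -scaleNr !opprB addrC.
  rewrite normrN [`|b - a|]distrC; apply: W; last exact: ltW.
  by rewrite minC maxC.
have Dw (t : R) : is_derive t 1 (fun s => v s - s *: c) (d t - c).
  apply: is_deriveB; have := is_derive_mull 1 t.
  by move/(is_derive_scalel c); under eq_fun do rewrite mul1r; rewrite scale1r.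
have Dp (t : R) : is_derive t 1 (fun s : R => e * s) e by exact: is_derive_mull.
have cont (V : normedModType R) (f g : R -> V) :
    (forall t : R, is_derive t 1 f (g t)) -> {within `[a, b], continuous f}.
  move=> Df; apply: continuous_subspaceT => t.
  exact: is_derive_continuous (Df t).
have := mean_value_inequality Hnorm ab (fun t _ => Dw t) (fun t _ => Dp t)
  (cont _ _ _ Dw) (cont _ _ _ Dp).
rewrite -mulrBr ger0_norm ?subr_ge0//.
have -> : v b - b *: c - (v a - a *: c) = v b - v a - (b - a) *: c.
  by rewrite scalerBl !opprD !opprK addrACA.
apply => t /andP[ta tb]; apply: dc.
by rewrite (min_l ab) (max_r ab) !ltW.
Qed.

(** Since the curves agree at [0], locally uniform convergence of the
    velocities forces convergence of the curves.  The derivative of the limit is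
    found by comparing each [v_ n] near [t] with uniform motion of velocity
    [d t], with an error that does not depend on [n]. *)
Lemma primitive_of_limit (v_ d_ : nat -> R -> H) (d : R -> H) (a : H) :
  (forall n, v_ n 0 = a) ->
  (forall n (t : R), is_derive t 1 (v_ n) (d_ n t)) ->
  (forall n, continuous (d_ n)) ->
  (forall T e : R, 0 < e ->
     \forall n \near \oo, forall t, `|t| <= T -> `|d_ n t - d t| <= e) ->
  exists v : R -> H,
    [/\ v 0 = a, forall t : R, is_derive t 1 v (d t) &
        forall t, v_ n t @[n --> \oo] --> v t].
Proof.
move=> v0 Dv cd dd.
(* Velocities at distance at most [e / (4 * (`|t| + 1))] from [d] keep the curves
   at distance less than [e] at time [t]. *)
have cvgv t : cvgn (v_ ^~ t).
  apply/cauchy_cvgP/cauchy_exP => e e0.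
  have e'0 : 0 < e / (4 * (`|t| + 1)).
    by rewrite divr_gt0 ?mulr_gt0 ?ltr_wpDl.
  have [N _ dN] := dd `|t| _ e'0; exists (v_ N t), N => // n Nn /=.
  rewrite -ball_normE /=.
  have := @derive_near_constant (v_ N \- v_ n) (fun s => d_ N s - d_ n s) 0
    (e / (4 * (`|t| + 1)) + e / (4 * (`|t| + 1))) 0 t
    (fun s => is_deriveB (Dv N s) (Dv n s)).
  rewrite /= !v0 subrr !subr0 scaler0 subr0.
  have H1 s : Num.min 0 t <= s <= Num.max 0 t ->
      `|d_ N s - d_ n s - 0|
        <= e / (4 * (`|t| + 1)) + e / (4 * (`|t| + 1)).
    move=> st; rewrite subr0 -(subrKA (d s)) (le_trans (ler_normD _ _))//.
    have {}st : `|s| <= `|t| by move: (dist_between st); rewrite !subr0.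
    by rewrite lerD// ?(dN N)//= distrC (dN n).
  move/(_ H1) => /le_lt_trans; apply.
  have tp : 0 < `|t| + 1 by rewrite ltr_wpDl.
  have eE : e = 4 * (`|t| + 1) * (e / (4 * (`|t| + 1))).
    by field; rewrite gt_eqF.
  rewrite [ltRHS]eE.
  by have := normr_ge0 t; move: e'0; nra.
pose v t := limn (v_ ^~ t).
have cvd : continuous d.
  move=> t; apply/cvgrPdist_le => e e0.
  have e3 : 0 < e / 3 by rewrite divr_gt0.
  have [N _ /(_ N (leqnn N)) dN] := dd (`|t| + 1) _ e3.
  have := cd N t; move/cvgrPdist_le => /(_ _ e3) cN.
  near=> s.
  have sT : `|s| <= `|t| + 1.
    rewrite -(subrK t s) (le_trans (ler_normD _ _))// addrC lerD2l distrC.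
    by near: s; apply: (@cvgr_dist_le _ _ _ _ _ id t) => //; exact: cvg_id.
  rewrite -(subrKA (d_ N t)) -(subrKA (d_ N s) (d_ N t)).
  rewrite (le_trans (ler_normD _ _))//.
  have -> : e = e / 3 + (e / 3 + e / 3) by field.
  rewrite lerD//; first by rewrite distrC dN// lerDl.
  rewrite (le_trans (ler_normD _ _))// lerD//; last exact: dN.
  by near: s.
exists v; split.
- apply/cvg_lim => //; under eq_fun do rewrite v0; exact: cvg_cst.
- move=> t; apply/is_deriveP; apply/cvgrPdist_le => e e0.
  have e2 : 0 < e / 2 by rewrite divr_gt0.
  have [N _ dN] := dd (`|t| + 1) _ e2.
  have := cvd t; move/cvgrPdist_le => /(_ _ e2) [del /= del0 cdel].
  near=> h.
  have h0 : h != 0 by near: h; exact: nbhs_dnbhs_neq.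
  have hd : `|h| < Num.min del 1.
    by near: h; apply: dnbhs0_lt; rewrite lt_min del0 ltr01.
  have lim : `|v (h + t) - v t - h *: d t| <= e * `|h|.
    have : `|v_ n (h + t) - v_ n t - h *: d t| @[n --> \oo] -->
           `|v (h + t) - v t - h *: d t|.
      apply: cvg_norm; apply: cvgB; last exact: cvg_cst.
      by apply: cvgB; exact: cvgv.
    move/cvgr_to_le; apply; exists N => // n /= Nn.
    have := @derive_near_constant (v_ n) (d_ n) (d t) e t (h + t) (Dv n).
    rewrite addrK; apply => s st.
    have sth : `|s - t| <= `|h| by move: (dist_between st); rewrite addrK.
    have [hd1 hd2] : `|h| < del /\ `|h| < 1.
      by move: hd; rewrite lt_min => /andP[].
    rewrite -(subrKA (d s)) (le_trans (ler_normD _ _))// [e]splitr lerD//.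
      apply: dN => //.
      rewrite -(subrK t s) (le_trans (ler_normD _ _))// addrC lerD2l.
      exact: le_trans sth (ltW _).
    rewrite distrC; apply: cdel => /=; rewrite distrC.
    exact: le_lt_trans sth _.
  have -> : d t - h^-1 *: (v (h + t) - v t) =
            - (h^-1 *: (v (h + t) - v t - h *: d t)).
    by rewrite [in RHS]scalerBr scalerA mulVf// scale1r opprB.
  by rewrite normrN normrZ normfV mulrC ler_pdivrMr ?normr_gt0.
- by move=> t; exact: cvgv.
Unshelve. all: by end_near. Qed.
End Limit.

(** * Tent functions *)

Section Ramp.
Context (R : realType).
Implicit Types x : R.

Definition ramp x : R := Num.max 0 (Num.min 1 x).
Definition tent x : R := ramp (x + 1) - ramp x.

Lemma ramp_le0 x : x <= 0 -> ramp x = 0.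
Proof. by move=> x0; rewrite /ramp max_l// ge_min x0 orbT. Qed.

Lemma ramp_ge1 x : 1 <= x -> ramp x = 1.
Proof. by move=> x1; rewrite /ramp (min_l x1) max_r. Qed.

Lemma ramp_homo x y : x <= y -> ramp x <= ramp y.
Proof.
move=> xy; rewrite /ramp ge_max le_max lexx/= le_max.
by rewrite (le_min2 (lexx 1) xy) orbT.
Qed.

Lemma ramp_continuous : continuous ramp.
Proof.
move=> x; apply: continuous_max; first exact: cvg_cst.
by apply: continuous_min; [exact: cvg_cst|exact: cvg_id].
Qed.

Lemma tent_ge0 x : 0 <= tent x.
Proof. by rewrite subr_ge0 ramp_homo// lerDl. Qed.

Lemma tent_neq0 x : tent x != 0 -> `|x| <= 1.
Proof.
rewrite ler_norml; apply: contra_neqT; rewrite negb_and -!ltNge => /orP[x1|x1].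
  by rewrite /tent !ramp_le0 ?subrr//; lra.
by rewrite /tent !ramp_ge1 ?subrr//; lra.
Qed.

(** The tents centred at the integers form a partition of unity: writing a tent
    as a difference of ramps makes the sum telescope. *)
Lemma sum_tent (M : nat) x : 0 <= x -> x + 1 <= M%:R ->
  \sum_(k < M) tent (x - k%:R) = 1.
Proof.
move=> x0 xM.
have -> : \sum_(k < M) tent (x - k%:R) = ramp (x + 1) - ramp (x + 1 - M%:R).
  elim: M {xM} => [|M IH]; first by rewrite big_ord0 subr0 subrr.
  have E1 : x - M%:R + 1 = x + 1 - M%:R by ring.
  have E2 : x + 1 - M.+1%:R = x - M%:R by rewrite -natr1; ring.
  by rewrite big_ord_recr/= IH /tent E1 E2 addrA subrK.
by rewrite ramp_ge1 ?lerDr// ramp_le0 ?subr0// subr_le0.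
Qed.

Lemma is_derive_Rintegral (f : R -> R) (c x : R) : continuous f -> c < x ->
  is_derive x 1 (fun y => \int[@lebesgue_measure R]_(t in `[c, y]) f t) (f x).
Proof.
move=> cf cx.
have xx1 : x < x + 1 by rewrite ltrDl.
have fi : (@lebesgue_measure R).-integrable `[c, x + 1] (EFin \o f).
  apply: continuous_compact_integrable; first exact: segment_compact.
  exact: continuous_subspaceT.
have [dC C'] := continuous_FTC1_closed xx1 fi cx (cf x).
by split; [exact: dC|rewrite -derive1E; exact: C'].
Qed.

(** The integral from [-1] has a derivative at the points above [-1] only;
    at the other points the ramp and its integral both vanish. *)
Lemma ramp_primitive : exists C : R -> R, forall x, is_derive x 1 C (ramp x).
Proof.
exists (fun x => \int[@lebesgue_measure R]_(t in `[-1, x]) ramp t) => x.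
have [x1|x1] := ltP (-1) x; first exact: (is_derive_Rintegral ramp_continuous).
rewrite ramp_le0; last lra.
apply: near_eq_is_derive (is_derive_cst 0 x 1).
near=> y; rewrite [RHS](@eq_Rintegral _ _ _ _ _ (cst 0)).
  by rewrite Rintegral_cst//= mul0r.
move=> t; rewrite inE/= in_itv/= => /andP[_ ty]; rewrite ramp_le0//.
rewrite (le_trans ty)// ltW//; near: y; apply: lt_nbhsl; lra.
Unshelve. all: by end_near. Qed.
End Ramp.

(** * Primitives of continuous curves *)

Section Primitive.
Context (R : realType) (H : completeNormedModType R) (dot : {dot H for idfun}).
Hypothesis Hnorm : induces_norm dot.

(** Heine-Cantor on [[- T, T]].  Only [t] is restricted to the compact interval,
    so that the nodes of an interpolation may fall slightly outside it. *)
Lemma continuous_uniformly (f : R -> H) (T e : R) : continuous f -> 0 < e ->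
  exists2 del, 0 < del & forall t, `|t| <= T ->
    forall s, `|s - t| < del -> `|f s - f t| <= e.
Proof.
move=> cf e0.
have : \forall del \near (0 : R)^'+, `[- T, T] `<=` [set t |
    forall s, `|s - t| < del -> `|f s - f t| <= e].
  have /compact_near_coveringP := @segment_compact R (- T) T.
  apply => t _.
  have e2 : 0 < e / 2 by rewrite divr_gt0.
  have := cf t; move/cvgrPdist_le => /(_ _ e2) [eta /= eta0 ct].
  exists (ball t (eta / 2), [set d : R | d < eta / 2]) => /=.
    split; first by apply: nbhsx_ballx; rewrite divr_gt0.
    by apply: nbhs_right_lt; rewrite divr_gt0.
  move=> [t' d] /= [tt' dd] s st.
  rewrite -(subrKA (f t)) (le_trans (ler_normD _ _))// [e]splitr lerD//.
    rewrite distrC ct//= -(subrKA t') [eta]splitr.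
    rewrite (le_lt_trans (ler_normD _ _))// ltrD// distrC.
    exact: lt_trans st dd.
  by rewrite ct//= (lt_trans tt')// ltr_pdivrMr// ltr_pMr// ltr1n.
move=> near_d.
have [d [d0 dP]] := filter_ex (filterI (nbhs_right_gt (0 : R)) near_d).
by exists d => // t tT; apply: dP; rewrite /= in_itv/= -ler_norml.
Qed.

(** The curve [f] is interpolated linearly at the nodes [node n k], spread
    over [[- N n, N n]] with mesh [1 / N n].  The interpolation [d_ n] is a
    finite combination of fixed vectors with tent functions as coefficients, so
    it has the explicit primitive [w_ n], and it converges to [f] locally
    uniformly. *)
Lemma primitive_exists (f : R -> H) : continuous f ->
  exists v : R -> H, v 0 = 0 /\ forall t : R, is_derive t 1 v (f t).
Proof.
move=> cf; have [C DC] := ramp_primitive R.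
pose N n : R := n.+1%:R.
pose M n := (2 * n.+1 ^ 2)%N.
pose x n t k : R := N n * t + N n ^+ 2 - k%:R.
pose node n k : R := (k%:R - N n ^+ 2) / N n.
pose d_ n (t : R) := \sum_(k < M n) tent (x n t k) *: f (node n k).
pose w_ n (t : R) := \sum_(k < M n)
  ((N n)^-1 * (C (x n t k + 1) - C (x n t k))) *: f (node n k).
have Npos n : 0 < N n by rewrite ltr0n.
have DC_affine n k c (t : R) :
    is_derive t 1 (fun s => C (x n s k + c)) (N n * ramp (x n t k + c)).
  have Dx : is_derive t 1 (fun s => x n s k + c) (N n).
    apply/is_deriveP; apply: cvg_near_cst; near=> h.
    rewrite (_ : _ - _ = N n * h); last by rewrite /x; ring.
    rewrite /GRing.scale /= mulrCA mulVf ?mulr1//.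
    by near: h; exact: nbhs_dnbhs_neq.
  by rewrite mulrC; exact: is_derive1_comp.
have Dw n (t : R) : is_derive t 1 (w_ n) (d_ n t).
  have -> : w_ n = \sum_(k < M n) (fun t =>
      ((N n)^-1 * (C (x n t k + 1) - C (x n t k))) *: f (node n k)).
    by apply/funext => s; rewrite fct_sumE.
  apply: is_derive_sum => k; apply: is_derive_scalel.
  have -> : tent (x n t k) =
      (N n)^-1 * (N n * ramp (x n t k + 1) - N n * ramp (x n t k)).
    by rewrite -mulrBr mulKf// gt_eqF.
  have D1 := DC_affine n k 1 t.
  have D0 : is_derive t 1 (fun s => C (x n s k)) (N n * ramp (x n t k)).
    by have := DC_affine n k 0 t; under eq_fun do rewrite addr0; rewrite addr0.
  by apply: is_deriveZ; exact: is_deriveB.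
have cd n : continuous (d_ n).
  move=> t; apply: (@cvg_big H _ +%R 0); first exact: add_continuous.
  move=> k _; apply: cvgZr_tmp.
  have cx : (fun s => x n s k) @ t --> x n t k.
    apply: cvgB; last exact: cvg_cst.
    apply: cvgD; last exact: cvg_cst.
    by apply: cvgM; [exact: cvg_cst|exact: cvg_id].
  apply: cvgB; last by apply: (cvg_comp _ _ cx); exact: ramp_continuous.
  have cx1 : (fun s => x n s k + 1) @ t --> x n t k + 1.
    by apply: cvgD => //; exact: cvg_cst.
  by apply: (cvg_comp _ _ cx1); exact: ramp_continuous.
have [|n t||T e e0|v [v0 Dv _]] :=
  @primitive_of_limit R H dot Hnorm (fun n t => w_ n t - w_ n 0) d_ f 0.
- by move=> n; rewrite subrr.
- by rewrite -[d_ n t]subr0; apply: is_deriveB.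
- exact: cd.
- have [del del0 cunif] := continuous_uniformly T cf e0.
  near=> n => t tT.
  have Ndel : (N n)^-1 < del.
    by near: n; exact: near_infty_natSinv_lt (PosNum del0).
  have NT : T + 1 <= N n.
    rewrite /N -natr1 lerD2r; near: n; exact: nbhs_infty_ger.
  have sum1 : \sum_(k < M n) tent (x n t k) = 1.
    have N1 : 1 <= N n by rewrite ler1n.
    move: tT; rewrite ler_norml => /andP[t1 t2].
    apply: sum_tent; first by nra.
    by rewrite /M natrM natrX -/(N n); nra.
  rewrite -[f t]scale1r -sum1 scaler_suml -sumrB -[e]mul1r -sum1 mulr_suml.
  apply: (le_trans (ler_norm_sum _ _ _)); apply: ler_sum => k _.
  rewrite -scalerBr normrZ ger0_norm ?tent_ge0//.
  have [->|/tent_neq0 xk] := eqVneq (tent (x n t k)) 0; first by rewrite !mul0r.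
  rewrite ler_wpM2l ?tent_ge0// cunif//.
  have -> : node n k - t = - ((N n)^-1 * x n t k).
    by rewrite /node /x; field; rewrite gt_eqF.
  rewrite normrN normrM gtr0_norm ?invr_gt0// (le_lt_trans _ Ndel)//.
  by rewrite ler_piMr// invr_ge0 ltW.
- by exists v.
Unshelve. all: by end_near. Qed.
End Primitive.

(** * Global solutions of Lipschitz equations *)

Section Picard.
Context (R : realType) (H : completeNormedModType R) (dot : {dot H for idfun}).
Hypothesis Hnorm : induces_norm dot.

Lemma geometric_near0 (K e : R) : 0 < e ->
  \forall n \near \oo, K / 2 ^+ n <= e.
Proof.
move=> e0; have K0 : 0 < e / (`|K| + 1) by rewrite divr_gt0// ltr_wpDl.
near=> n.
have : 1 / 2 ^+ n < e / (`|K| + 1).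
  by near: n; exact: near_infty_natSinv_expn_lt (PosNum K0).
rewrite ltr_pdivlMr ?ltr_wpDl// div1r => /ltW; apply: le_trans.
by rewrite mulrC ler_wpM2l// (le_trans (ler_norm K))// lerDl.
Unshelve. all: by end_near. Qed.

Lemma geometric_cauchy (x : nat -> H) (K : R) :
  (forall n, `|x n.+1 - x n| <= K / 2 ^+ n) ->
  cvgn x /\ forall n, `|x n - limn x| <= 2 * K / 2 ^+ n.
Proof.
move=> xK.
have tail n k : `|x (n + k)%N - x n| <= 2 * K / 2 ^+ n - 2 * K / 2 ^+ (n + k).
  elim: k => [|k IH]; first by rewrite addn0 !subrr normr0.
  rewrite addnS -(subrKA (x (n + k)%N)) (le_trans (ler_normD _ _))//.
  have := xK (n + k)%N; move: IH; rewrite exprS invfM.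
  move: (2 ^+ (n + k))^-1 => q; lra.
have K0 : 0 <= K by have := xK 0; rewrite expr0 divr1; exact: le_trans.
have bound m n : (n <= m)%N -> `|x m - x n| <= 2 * K / 2 ^+ n.
  move=> /subnKC <-; apply: le_trans (tail _ _) _.
  by rewrite gerBl divr_ge0 ?mulr_ge0// exprn_ge0.
have cx : cvgn x.
  apply/cauchy_cvgP/cauchy_exP => e e0.
  have e2 : 0 < e / 2 by rewrite divr_gt0.
  have [N _ /(_ N (leqnn N)) NK] := geometric_near0 (2 * K) e2.
  exists (x N), N => // n /= Nn; rewrite -ball_normE /= distrC.
  rewrite (le_lt_trans (bound _ _ Nn))// (le_lt_trans NK)//.
  by rewrite ltr_pdivrMr// ltr_pMr// ltr1n.
split=> // n.
have : `|x n - x m| @[m --> \oo] --> `|x n - limn x|.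
  by apply: cvg_norm; apply: cvgB; [exact: cvg_cst|exact: cx].
move/cvgr_to_le; apply; exists n => // m /= nm.
by rewrite distrC bound.
Qed.

(** Picard iteration.  At negative times the velocity is evaluated at the
    position at time [0]: this leaves the equation unchanged for [t >= 0],
    gives two-sided derivatives at [0], and confines the estimates to
    [t >= 0]. *)
Lemma cauchy_problem (Psi : R -> H -> H) (u0 : H) :
  (forall w : R -> H, continuous w -> continuous (fun t => Psi t (w t))) ->
  (forall T : R, exists L : R, forall t x y, `|t| <= T ->
     `|Psi t x - Psi t y| <= L * `|x - y|) ->
  exists u : R -> H, u 0 = u0 /\
    forall t : R, is_derive t 1 u (Psi t (u (Num.max t 0))).
Proof.
move=> cPsi lipPsi.
have [prim primP] : {prim : (R -> H) -> R -> H & forall f, continuous f ->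
    prim f 0 = 0 /\ forall t : R, is_derive t 1 (prim f) (f t)}.
  apply: (@choice _ _ (fun (f v : R -> H) => continuous f ->
    v 0 = 0 /\ forall t : R, is_derive t 1 v (f t))) => f.
  have [cf|ncf] := pselect (continuous f); last by exists f.
  by have [v vP] := primitive_exists Hnorm cf; exists v.
pose frozen (w : R -> H) (t : R) := Psi t (w (Num.max t 0)).
have cfrozen w : continuous w -> continuous (frozen w).
  move=> cw; apply: (cPsi (fun t => w (Num.max t 0))) => t.
  apply: (@continuous_comp _ _ _ (fun t : R => Num.max t 0) w); last exact: cw.
  by apply: continuous_max; [exact: cvg_id|exact: cvg_cst].
pose it := fix it n : R -> H :=
  if n is m.+1 then fun t => u0 + prim (frozen (it m)) t else cst u0.
have it_der : forall n, continuous (it n) ->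
    forall t : R, is_derive t 1 (it n.+1) (frozen (it n) t).
  move=> n cn t /=; rewrite -[frozen _ _]add0r.
  by apply: is_deriveD; exact: (primP _ (cfrozen _ cn)).2.
have it_cont n : continuous (it n).
  elim: n => [|n IH]; first by move=> t; exact: cvg_cst.
  by move=> t; exact: is_derive_continuous (it_der n IH t).
have {}it_der n := it_der n (it_cont n).
have it0 n : it n 0 = u0.
  by case: n => //= n; rewrite (primP _ (cfrozen _ (it_cont n))).1 addr0.
have step T : exists K, forall n t, `|t| <= T ->
    `|frozen (it n.+1) t - frozen (it n) t| <= K / 2 ^+ n.
  have [T0|T0] := ltP T 0.
    by exists 0 => n t tT; have := le_lt_trans tT T0; rewrite normr_lt0.
  have [L0 HL0] := lipPsi T; pose L := Num.max L0 0.
  have L_ge0 : 0 <= L by rewrite le_max lexx orbT.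
  have HL t x y : `|t| <= T -> `|Psi t x - Psi t y| <= L * `|x - y|.
    move=> tT; apply: le_trans (HL0 _ _ _ tT) _.
    by rewrite ler_wpM2r// le_max lexx.
  (* The weight [expR (2 * L * t)] makes each Picard step a contraction by the
     factor [1 / 2] on the whole of [[0, T]], whatever the length of this
     interval is. *)
  have [c _ cmax] : exists2 c, c \in `[0, T]%R & forall t, t \in `[0, T]%R ->
      `|it 1 t - it 0 t| <= `|it 1 c - it 0 c|.
    apply: EVT_max => //; apply: continuous_subspaceT => t.
    by apply: cvg_norm; apply: cvgB; exact: it_cont.
  set C := `|it 1 c - it 0 c| in cmax.
  have C0 : 0 <= C by exact: normr_ge0.
  have contract n t : 0 <= t <= T ->
      `|it n.+1 t - it n t| <= C / 2 ^+ n * expR (2 * L * t).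
    elim: n t => [|n IH] t tT.
      rewrite expr0 divr1 (le_trans (cmax t _)) ?in_itv//.
      by rewrite ler_peMr// -expR0 ler_expR !mulr_ge0//; case/andP: tT.
    have [t0 tT'] := andP tT.
    pose phi (s : R) := C / 2 ^+ n.+1 * expR (2 * L * s).
    have Dphi (s : R) : is_derive s 1 phi (L * (C / 2 ^+ n * expR (2 * L * s))).
      have Dlin := is_derive_mull (2 * L) s.
      have -> : L * (C / 2 ^+ n * expR (2 * L * s)) =
          C / 2 ^+ n.+1 * (expR (2 * L * s) * (2 * L)).
        by rewrite exprS; field; rewrite expf_neq0.
      by apply: is_deriveZ; apply: is_derive1_comp.
    have Dv (s : R) : is_derive s 1 (fun s => it n.+2 s - it n.+1 s)
        (frozen (it n.+1) s - frozen (it n) s).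
      by apply: is_deriveB; exact: it_der.
    have cont (V : normedModType R) (f g : R -> V) :
        (forall t : R, is_derive t 1 f (g t)) -> {within `[0, t], continuous f}.
      move=> Df; apply: continuous_subspaceT => s.
      exact: is_derive_continuous (Df s).
    have := mean_value_inequality Hnorm t0 (fun s _ => Dv s)
      (fun s _ => Dphi s) (cont _ _ _ Dv) (cont _ _ _ Dphi).
    rewrite !it0 subrr subr0 => H1; apply: le_trans (H1 _) _.
      move=> s /andP[s0 st]; rewrite /frozen (max_l (ltW s0)).
      have sT : s <= T by rewrite (le_trans (ltW st)).
      rewrite (le_trans (HL _ _ _ _)) ?ger0_norm ?(ltW s0)//.
      by rewrite ler_wpM2l// IH// (ltW s0).
    by rewrite gerBl mulr_ge0 ?expR_ge0// divr_ge0// exprn_ge0.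
  exists (L * (C * expR (2 * L * T))) => n t tT.
  rewrite (le_trans (HL _ _ _ tT))// -[leRHS]mulrA ler_wpM2l//.
  have mT : 0 <= Num.max t 0 <= T.
    by rewrite le_max lexx orbT/= ge_max T0 andbT (le_trans (ler_norm t)).
  rewrite (le_trans (contract n _ mT))// mulrAC ler_wpM2r ?invr_ge0 ?exprn_ge0//.
  rewrite ler_wpM2l// ler_expR ler_wpM2l ?mulr_ge0//.
  by case/andP: mT.
pose d t := limn (fun n => frozen (it n) t).
have dcvg T : exists K, forall n t, `|t| <= T ->
    `|frozen (it n) t - d t| <= K / 2 ^+ n.
  have [K HK] := step T; exists (2 * K) => n t tT.
  by have [_] := geometric_cauchy (fun n => HK n t tT); exact.
have dunif (T e : R) : 0 < e -> \forall n \near \oo, forall t, `|t| <= T ->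
    `|frozen (it n) t - d t| <= e.
  move=> e0; have [K HK] := dcvg T; near=> n => t tT.
  by rewrite (le_trans (HK n t tT))//; near: n; exact: geometric_near0.
have [u [u0E Du cu]] := primitive_of_limit Hnorm (fun n => it0 n.+1) it_der
  (fun n => cfrozen _ (it_cont n)) dunif.
(* The velocities of the iterates have the limit [d t]; by the Lipschitz
   condition they also converge to the value of the field along the limit. *)
exists u; split=> // t; suff -> : Psi t (u (Num.max t 0)) = d t by exact: Du.
have [K HK] := dcvg `|t|; have [L HL] := lipPsi `|t|.
have c1 : frozen (it n.+1) t @[n --> \oo] --> d t.
  apply/cvgrPdist_le => e e0; near=> n; rewrite distrC.
  rewrite (le_trans (HK n.+1 t (lexx _)))//.
  near: n; have [N _ HN] := geometric_near0 K e0.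
  by exists N => // n /= /leqW/HN.
have c2 : frozen (it n.+1) t @[n --> \oo] --> Psi t (u (Num.max t 0)).
  apply/cvgrPdist_le => e e0.
  have e'0 : 0 < e / (`|L| + 1) by rewrite divr_gt0// ltr_wpDl.
  have := cu (Num.max t 0); move/cvgrPdist_le => /(_ _ e'0) cuM.
  near=> n; rewrite /frozen (le_trans (HL _ _ _ (lexx _)))//.
  have -> : e = (`|L| + 1) * (e / (`|L| + 1)).
    by field; rewrite gt_eqF// ltr_wpDl.
  rewrite (le_trans (ler_wpM2r (normr_ge0 _) (ler_norm L)))//.
  rewrite ler_pM ?lerDl//.
  by near: n.
exact: cvg_unique c2 c1.
Unshelve. all: by end_near. Qed.
End Picard.

(** * Integrals of lower bounds of a derivative *)

Lemma comp_within_continuous (T U V : topologicalType) (A : set U)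
    (k : T -> U) (f : U -> V) :
  continuous k -> (forall x, A (k x)) -> {within A, continuous f} ->
  continuous (f \o k).
Proof.
move=> ck Ak /subspace_continuousP cf x.
move=> P /(cf _ (Ak x)) AP.
have {}AP : nbhs x (fun y => A (k y) -> P (f (k y))) := ck x _ AP.
by apply: filterS AP => y; apply; exact: Ak.
Qed.

Section Increment.

Context (R : realType).
Local Notation mu := (@lebesgue_measure R).

(** This is one half of the fundamental theorem of calculus, valid for every
    nondecreasing differentiable [th], whatever the regularity of [dth].
    The difference quotients of [th], extended by constants outside [[a, b]],
    are nonnegative and have integrals at most [th b - th a]; Fatou's lemma
    passes this bound to their pointwise limit [dth]. *)
Lemma integral_le_increment (th dth g : R -> R) (a b : R) : a < b ->
  {within `[a, b], continuous th} ->
  (forall t, a < t < b -> is_derive t 1 th (dth t)) ->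
  (forall t, a < t < b -> 0 <= g t <= dth t) ->
  mu.-integrable `[a, b] (EFin \o g) ->
  \int[mu]_(t in `[a, b]) g t <= th b - th a.
Proof.
move=> ab cth Dth gth ig.
(* [k] is the projection of the line onto [[a, b]], [f] the extension of [th] by
   constants and [q n] its difference quotient with increment [1 / n.+1]. *)
pose k (t : R) := Num.max a (Num.min b t).
have k_homo s t : s <= t -> k s <= k t.
  by move=> st; rewrite /k ge_max !le_max lexx/= (le_min2 (lexx b) st) orbT.
have kin t : k t \in `[a, b].
  by rewrite in_itv/= /k le_max lexx/= ge_max (ltW ab) ge_min lexx.
have kid t : a <= t <= b -> k t = t.
  by case/andP=> at' tb; rewrite /k (min_r tb) (max_r at').
have kb t : b <= t -> k t = b.
  by move=> bt; rewrite /k (min_l bt) max_r// ltW.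
pose f t := th (k t).
have cf : continuous f.
  apply: (@comp_within_continuous _ _ _ `[a, b]%classic k th) => //.
  move=> t; apply: continuous_max; first exact: cvg_cst.
  by apply: continuous_min; [exact: cvg_cst|exact: cvg_id].
have th_homo : {in `[a, b] &, {homo th : x y / x <= y}}.
  apply: ger0_derive1_le_cc => // t; rewrite in_itv/= => tab.
    by have [] := Dth t tab.
  rewrite derive1E; have [_ ->] := Dth t tab.
  by case/andP: (gth t tab) => /le_trans; apply.
have f_homo s t : s <= t -> f s <= f t.
  by move=> st; apply: th_homo => //; exact: k_homo.
pose q n (t : R) : R := n.+1%:R * (f (t + n.+1%:R^-1) - f t).
have cq n : continuous (q n).
  move=> t; apply: cvgM; first exact: cvg_cst.
  apply: cvgB; last exact: cf.
  have cs : (fun t => t + n.+1%:R^-1) @ t --> t + n.+1%:R^-1.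
    by apply: cvgD; [exact: cvg_id|exact: cvg_cst].
  by apply: (cvg_comp _ _ cs); exact: cf.
have q_ge0 n t : 0 <= q n t.
  by rewrite mulr_ge0// subr_ge0 f_homo// lerDl.
(* With a primitive [P] of [f], the integral of [q n] is the difference of the
   means of [f] over the intervals of length [h] beginning at [b] and at [a]. *)
have q_int n : (\int[mu]_(t in `[a, b]) (q n t)%:E <= (th b - th a)%:E)%E.
  pose P (x : R) := \int[mu]_(t in `[a - 1, x]) f t.
  pose h : R := n.+1%:R^-1.
  have h0 : 0 < h by rewrite invr_gt0.
  have DP (x : R) : a - 1 < x -> is_derive x 1 P (f x).
    exact: is_derive_Rintegral.
  pose Q x := n.+1%:R * (P (x + h) - P x).
  have DQ (x : R) : a - 1 < x -> is_derive x 1 Q (q n x).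
    move=> ax; have D1 := DP x ax.
    have D2 : is_derive x 1 (fun y => P (y + h)) (f (x + h)).
      have DPh : is_derive (x + h) 1 P (f (x + h)) by apply: DP; lra.
      have := @is_derive1_comp R P (shift h) x _ _ DPh (is_derive_shift x 1 h).
      by rewrite mulr1.
    by apply: is_deriveZ; exact: is_deriveB.
  have cQ (x : R) : a - 1 < x -> {for x, continuous Q}.
    by move=> ax; exact: is_derive_continuous (DQ x ax).
  rewrite (@continuous_FTC2 _ _ Q)//; last 3 first.
  - exact: continuous_subspaceT.
  - split=> [x||].
    + by rewrite in_itv/= => /andP[ax _]; have [] := DQ x ltac:(lra).
    + by apply: cvg_at_right_filter; apply: cQ; lra.
    + by apply: cvg_at_left_filter; apply: cQ; lra.
  - move=> x; rewrite in_itv/= => /andP[ax _]; rewrite derive1E.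
    by have [_ ->] := DQ x ltac:(lra).
  rewrite -EFinB lee_fin.
  have PMVT x : a <= x -> exists2 c, x <= c <= x + h & P (x + h) - P x = f c * h.
    move=> ax; have [|y yx||c + ->] := @MVT_segment _ P f x (x + h).
    - by rewrite lerDl ltW.
    - by apply: DP; move: yx; rewrite in_itv/= => /andP[]; lra.
    - apply: continuous_in_subspaceT => y; rewrite inE/= in_itv/= => /andP[xy _].
      by apply: is_derive_continuous (DP y _); lra.
    - by rewrite in_itv/= => xc; exists c => //; rewrite addrAC subrr add0r.
  have [cb /andP[bc _] Eb] := PMVT b (ltW ab).
  have [ca /andP[ac _] Ea] := PMVT a (lexx a).
  rewrite /Q Eb Ea !(mulrC _ h) !mulrA divff// !mul1r lerB//.
    by rewrite /f (kb _ bc).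
  have -> : th a = f a by rewrite /f kid// lexx ltW.
  exact: f_homo.
have qlim t : a < t < b -> (q n t)%:E @[n --> \oo] --> (dth t)%:E.
  move=> tab; have Df : is_derive t 1 f (dth t).
    have [at' tb] := andP tab; apply: near_eq_is_derive (Dth t tab).
    near=> s; rewrite /f kid//; apply/andP; split; apply: ltW; near: s.
      exact: lt_nbhsr.
    exact: lt_nbhsl.
  have /is_deriveP Dq := Df.
  have /(_ harmonic) := (cvgr_dnbhsP _ _ _).1 Dq.
  have : forall n, @harmonic R n != 0 by move=> n; rewrite invr_eq0 pnatr_eq0.
  move=> H1 /(_ (conj H1 cvg_harmonic)) H2.
  have -> : (fun n => (q n t)%:E) =
      EFin \o (fun n => (harmonic n)^-1 *: (f (harmonic n + t) - f t)).
    by apply/funext => n /=; rewrite /q [t + _]addrC invrK.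
  by apply: cvg_EFin => //; exact: nearW.
have mg : measurable_fun `]a, b[ (EFin \o g).
  apply: measurable_funS (measurable_int mu ig) => //.
  exact: subset_itv_oo_cc.
have gE : (\int[mu]_(t in `]a, b[) (g t)%:E <= (th b - th a)%:E)%E.
  have mq n : measurable_fun `]a, b[ (fun t => (q n t)%:E).
    apply/measurable_EFinP; apply: measurable_funTS.
    exact: continuous_measurable_fun.
  have q0 n t : `]a, b[%classic t -> (0 <= (q n t)%:E)%E.
    by move=> _; rewrite lee_fin.
  have mab := measurable_itv `]a, b[ : measurable (`]a, b[%classic : set R).
  have mdth : measurable_fun `]a, b[ (EFin \o dth).
    apply: (@emeasurable_fun_cvg _ _ R _ (fun n t => (q n t)%:E) _ mq) => t.
    by move=> tab; exact: qlim.
  have le1 : (\int[mu]_(t in `]a, b[) (g t)%:E <=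
              \int[mu]_(t in `]a, b[) (dth t)%:E)%E.
    apply: ge0_le_integral => //.
    - by move=> t tab; have /andP[g0 _] := gth t tab; exact: g0.
    - by move=> t tab; have /andP[_ gd] := gth t tab; exact: gd.
  apply: le_trans le1 _.
  have -> : (\int[mu]_(t in `]a, b[) (dth t)%:E =
             \int[mu]_(t in `]a, b[) limn_einf (fun n => (q n t)%:E))%E.
    apply: eq_integral => t; rewrite inE/= in_itv/= => tab.
    by rewrite (cvg_limn_einf_sup (qlim t tab)).1.
  apply: le_trans (fatou mu mab mq q0) _.
  rewrite limn_einf_lim; apply: lime_le; first exact: is_cvg_einfs.
  apply: nearW => n.
  apply: (@le_trans _ _ (\int[mu]_(t in `]a, b[) (q n t)%:E)%E).
    by apply: ereal_inf_lbound; exists n => /=.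
  rewrite -(@integral_itv_bndoo R a b (EFin \o q n) true false (mq n)).
  exact: q_int.
have gE' : (\int[mu]_(t in `[a, b]) (g t)%:E <= (th b - th a)%:E)%E.
  by rewrite (@integral_itv_bndoo R a b (EFin \o g) true false mg); exact: gE.
move: gE'; rewrite -(fineK (integrable_fin_num _ ig))//.
Unshelve. all: by end_near. Qed.
End Increment.

(** * Radial retraction onto a ball *)

Section Retraction.
Context (R : realType) (H : normedModType R).

Definition retract (c : H) (r : R) (x : H) : H :=
  c + (r / Num.max r `|x - c|) *: (x - c).

Context (c : H) (r : R).
Hypothesis r0 : 0 < r.

Let max_gt0 (x : H) : 0 < Num.max r `|x - c|.
Proof. by rewrite lt_max r0. Qed.

Lemma retract_cball x : cball c r (retract c r x).
Proof.
rewrite /cball /retract /= addrC addKr normrZ ger0_norm; last first.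
  by rewrite divr_ge0// ltW.
by rewrite mulrAC ler_pdivrMr// ler_wpM2l ?(ltW r0)// le_max lexx orbT.
Qed.

Lemma retract_id x : cball c r x -> retract c r x = x.
Proof.
rewrite /cball /retract /= => xr.
by rewrite max_l// divff ?gt_eqF// scale1r addrC subrK.
Qed.

(** Moving [x] with a fixed scaling factor accounts for one term [`|x - y|], the
    change of the scaling factor for another: hence the constant [2]. *)
Lemma retract_lipschitz x y : `|retract c r x - retract c r y| <= 2 * `|x - y|.
Proof.
rewrite /retract opprD addrACA subrr add0r.
set m := Num.max r `|x - c|; set k := Num.max r `|y - c|.
have m0 : 0 < m := max_gt0 x. have k0 : 0 < k := max_gt0 y.
have -> : (r / m) *: (x - c) - (r / k) *: (y - c) =
    (r / m) *: (x - y) + ((r / m) - (r / k)) *: (y - c).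
  rewrite scalerBl addrA -scalerDr; congr (_ *: _ - _).
  by rewrite addrA subrK.
have rm1 : r / m <= 1 by rewrite ler_pdivrMr// mul1r le_max lexx.
have rm0 : 0 <= r / m by rewrite divr_ge0// ltW.
have yk : `|y - c| / k <= 1 by rewrite ler_pdivrMr// mul1r le_max lexx orbT.
have km : `|k - m| <= `|x - y|.
  have -> : x - y = (x - c) - (y - c) by rewrite opprB addrA subrK.
  rewrite distrC; apply: le_trans (ler_dist_dist _ _).
  rewrite /m /k; move: `|x - c| `|y - c| => p q.
  have h1 := ler_norm (p - q); have h2 := ler_norm (q - p).
  rewrite distrC in h2; rewrite ler_norml; apply/andP.
  by case: (leP r p) => ?; case: (leP r q) => ?; split; lra.
rewrite (le_trans (ler_normD _ _))// mulr_natl mulr2n lerD//.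
  by rewrite normrZ (ger0_norm rm0) ler_piMl.
have -> : r / m - r / k = (r / m) * ((k - m) / k) by field; rewrite !gt_eqF.
rewrite normrZ !normrM !normfV.
rewrite (gtr0_norm k0) (gtr0_norm r0) (gtr0_norm m0).
have -> : r / m * (`|k - m| / k) * `|y - c| =
    (r / m) * (`|y - c| / k) * `|k - m| by field; rewrite !gt_eqF.
by rewrite (le_trans _ km)// ler_piMl// mulr_ile1// divr_ge0// ltW.
Qed.

Lemma retract_continuous : continuous (retract c r).
Proof.
move=> x; apply/cvgrPdist_le => e e0; near=> y.
rewrite (le_trans (retract_lipschitz _ _))// mulrC -ler_pdivlMr//.
near: y; have e2 : 0 < e / 2 by rewrite divr_gt0.
have /cvgrPdist_le : id @ x --> x by exact: cvg_id.
exact.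
Unshelve. all: by end_near. Qed.

End Retraction.

(** * Integrals over initial intervals of the half line *)

Section Cumulative.
Context (R : realType).
Local Notation mu := (@lebesgue_measure R).
Local Notation cumul g := (fun t : R => \int[mu]_(s in `[0, t]) g s).
Context (g : R -> R).
Hypothesis g_ge0 : forall t, 0 <= t -> 0 <= g t.
Hypothesis g_L1loc : L1loc_Rplus g.

Let integrable_cc t : mu.-integrable `[0, t] (EFin \o g).
Proof.
have [/g_L1loc//|t0] := leP 0 t.
by rewrite set_itv_ge ?bnd_simp -?ltNge//; exact: integrable_set0.
Qed.

Lemma cumul_continuous T : 0 <= T -> {within `[0, T], continuous (cumul g)}.
Proof.
by move=> T0; exact: parameterized_integral_continuous (integrable_cc T).
Qed.

Lemma cumul_continuous_at t : 0 < t -> {for t, continuous (cumul g)}.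
Proof.
move=> t0; have t1 : 0 < t + 1 by rewrite addr_gt0.
apply: (within_continuous_continuous t1 (cumul_continuous (ltW t1))).
by rewrite in_itv/= t0 ltrDl ltr01.
Qed.

Lemma is_derive_cumul t : 0 < t -> {for t, continuous g} ->
  is_derive t 1 (cumul g) (g t).
Proof.
move=> t0 ct; have tt1 : t < t + 1 by rewrite ltrDl.
have [dC C'] := continuous_FTC1_closed tt1 (integrable_cc (t + 1)) t0 ct.
by split; [exact: dC|rewrite -derive1E; exact: C'].
Qed.

Lemma cumul_homo : nondecreasing_fun (cumul g).
Proof.
move=> s t st; apply: fine_le; try exact: integrable_fin_num.
apply: ge0_subset_integral => //.
- exact: measurable_int (integrable_cc t).
- by move=> x; rewrite /= in_itv/= lee_fin => /andP[/g_ge0].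
- by apply: subset_itvl; rewrite bnd_simp.
Qed.

Lemma cumul_le : mu.-integrable `[0, +oo[ (EFin \o g) ->
  forall t, cumul g t <= \int[mu]_(s in `[0, +oo[) g s.
Proof.
move=> ig t; apply: fine_le; try exact: integrable_fin_num.
apply: ge0_subset_integral => //.
- exact: measurable_int ig.
- by move=> x; rewrite /= in_itv/= lee_fin andbT => /g_ge0.
- exact: subset_itvl.
Qed.

(** By monotone convergence along the intervals [[0, n]]. *)
Lemma cumul_cvgy : (\int[mu]_(s in `[0%R, +oo[) (g s)%:E = +oo)%E ->
  cumul g t @[t --> +oo] --> +oo.
Proof.
move=> goo; apply/cvgryPge => M.
pose F n := `[0, n%:R : R]%classic.
have nF : nondecreasing_seq F.
  by move=> m n mn; apply/subsetPset; apply: subset_itvl; rewrite bnd_simp ler_nat.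
have UF : \bigcup_n F n = `[0, +oo[%classic.
  have := @itv_bndy_bigcup_BRight R true 0; under eq_bigcupr do rewrite add0r.
  by move=> ->.
have mF n : measurable (F n) by exact: measurable_itv.
have mg n : measurable_fun (F n) (EFin \o g).
  exact: measurable_int (integrable_cc _).
have g0F n x : F n x -> (0 <= (EFin \o g) x)%E.
  by rewrite /F/= in_itv/= lee_fin => /andP[/g_ge0].
have := ge0_nondecreasing_set_cvg_integral (mu := lebesgue_measure)
  nF mF mg g0F.
rewrite UF goo => /cvgeyPge/(_ M) [N _ /(_ N (leqnn N))] MN.
near=> t; apply: (@le_trans _ _ (cumul g N%:R)).
  by rewrite /Rintegral -lee_fin fineK//; exact: integrable_fin_num.
by apply: cumul_homo; near: t; apply: nbhs_pinfty_ge; rewrite num_real.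
Unshelve. all: by end_near. Qed.

End Cumulative.

(** * A priori estimates *)

Section Estimates.
Context (R : realType) (H : completeNormedModType R) (dot : {dot H for idfun}).
Hypothesis Hnorm : induces_norm dot.

Lemma is_derive_half_line (v : R -> H) (t : R) (d : H) : is_derive t 1 v d ->
  (s - t)^-1 *: (v s - v t) @[s --> within [set s : R | 0 <= s] t^'] --> d.
Proof.
move=> /is_deriveP Dv.
have Dv' : (s - t)^-1 *: (v s - v t) @[s --> t^'] --> d.
  move=> P /Dv [e /= e0 eP]; exists e => //= s st sNt.
  have := eP (s - t); rewrite /= subrK; apply; last by rewrite subr_eq0.
  by rewrite sub0r normrN -normrN opprB.
exact: cvg_within_filter.
Qed.

(** First exit argument: the infimum of the times where [r <= p t] would be a
    time at which [p < r], and then [p < r] slightly later as well. *)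
Lemma lt_of_no_exit (p : R -> R) (r : R) : continuous p ->
  (forall T, 0 <= T -> (forall t, 0 <= t < T -> p t < r) -> p T < r) ->
  forall T, 0 <= T -> p T < r.
Proof.
move=> cp noexit T T0; rewrite ltNge; apply/negP => rT.
pose S := [set t | 0 <= t /\ r <= p t].
have infS : has_inf S by split; [exists T|exists 0 => t []].
have before t : 0 <= t < inf S -> p t < r.
  move=> /andP[t0 tS]; rewrite ltNge; apply/negP => rt.
  by have := ge_inf infS.2 (conj t0 rt : S t); rewrite leNgt tS.
have inf0 : 0 <= inf S by apply: lb_le_inf; [exists T|move=> t []].
have /(cvgr_lt _ (cp (inf S))) [e /= e0 eP] := noexit _ inf0 before.
have [s [s0 rs] se] := inf_adherent e0 infS.
have Ss : inf S <= s := ge_inf infS.2 (conj s0 rs : S s).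
have : p s < r.
  by apply: eP; rewrite /= ler0_norm ?subr_le0// opprB ltrBlDl.
by rewrite ltNge rs.
Qed.

(** If [F (v T)] is not [0] then neither is [F (v t)] at earlier times, as the
    norm does not increase; then [- ln `|F (v t)|] has a derivative at
    least [g t], and [integral_le_increment] applies. *)
Lemma norm_decay (F : H -> H) (v dv : R -> H) (g : R -> R) (T : R) : 0 <= T ->
  (forall x, differentiable F x) ->
  (forall t : R, is_derive t 1 v (dv t)) ->
  (forall t, 0 < t < T -> 0 <= g t) ->
  (@lebesgue_measure R).-integrable `[0, T] (EFin \o g) ->
  (forall t, 0 < t < T ->
     dot ('d F (v t) (dv t)) (F (v t)) <= - g t * `|F (v t)| ^+ 2) ->
  `|F (v T)| <= `|F (v 0)| * decay g T.
Proof.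
rewrite le_eqVlt => /predU1P[<- _ _ _ _ _|T0 dF Dv g0 ig Hdecr].
  by rewrite /decay set_itv1 Rintegral_set1 oppr0 expR0 mulr1.
pose psi (t : R) := dot (F (v t)) (F (v t)).
pose dpsi (t : R) := 2 * dot ('d F (v t) (dv t)) (F (v t)).
have Dpsi (t : R) : is_derive t 1 psi (dpsi t).
  have DF : is_derive t 1 (F \o v) ('d F (v t) (dv t)).
    have dv1 : differentiable v t by apply/derivable1_diffP; have [] := Dv t.
    have dFv : differentiable (F \o v) t by exact: differentiable_comp.
    split; first exact/derivable1_diffP.
    rewrite deriveE// diff_comp//= -[dv t](@derive_val _ _ _ _ _ _ _ (Dv t)).
    by rewrite deriveE.
  have := is_derive_dot Hnorm DF DF.
  by rewrite /= (dotC dot (F (v t))) -mulr2n -mulr_natl.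
have psiE t : psi t = `|F (v t)| ^+ 2 by rewrite /psi dotxx.
have cpsi : continuous psi by move=> t; exact: is_derive_continuous (Dpsi t).
have psi_le t : 0 <= t <= T -> psi T <= psi t.
  move=> /andP[t0 tT].
  apply: (@ler0_derive1_le_cc _ psi 0 T) => //.
  - move=> s; rewrite in_itv/= => sT; rewrite derive1E; have [_ ->] := Dpsi s.
    rewrite pmulr_rle0// (le_trans (Hdecr s sT))// mulNr oppr_le0.
    by rewrite mulr_ge0 ?exprn_ge0// g0.
  - exact: continuous_subspaceT.
  - by rewrite in_itv/= lexx andbT ltW.
  - by rewrite in_itv/= t0.
have [FT0|FT] := eqVneq (F (v T)) 0.
  by rewrite FT0 normr0 mulr_ge0// expR_ge0.
have psiT : 0 < psi T by rewrite psiE exprn_gt0// normr_gt0.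
have psi_gt0 t : 0 <= t <= T -> 0 < psi t by move/psi_le; exact: lt_le_trans.
(* [th] is [- ln] of the norm, written through the square [psi] whose derivative
   comes from bilinearity. *)
pose th (t : R) := - (2^-1 * ln (psi t)).
have Dth (t : R) : 0 <= t <= T ->
    is_derive t 1 th (- (2^-1 * ((psi t)^-1 * dpsi t))).
  move=> /psi_gt0 pt; apply: is_deriveN; apply: is_deriveZ.
  exact: (@is_derive1_comp R (@ln R) psi t _ _ (is_derive1_ln pt) (Dpsi t)).
have norm_gt0 t : 0 <= t <= T -> 0 < `|F (v t)|.
  move=> /psi_gt0; rewrite psiE normr_gt0; apply: contraTneq => ->.
  by rewrite normr0 expr0n ltxx.
have thE t : 0 <= t <= T -> th t = - ln `|F (v t)|.
  by move=> /norm_gt0 Ft; rewrite /th psiE lnXn//; field.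
have in0 : 0 <= (0 : R) <= T by rewrite lexx ltW.
have inT : 0 <= T <= T by rewrite lexx ltW.
have := @integral_le_increment R th
  (fun t => - (2^-1 * ((psi t)^-1 * dpsi t))) g 0 T T0.
rewrite !thE// opprK => incr.
have {incr} : \int[@lebesgue_measure R]_(t in `[0, T]) g t <=
    - ln `|F (v T)| + ln `|F (v 0)|.
  apply: incr.
  - apply: continuous_in_subspaceT => t; rewrite inE/= in_itv/= => tT.
    exact: is_derive_continuous (Dth t tT).
  - by move=> t /andP[t0 tT]; apply: Dth; rewrite !ltW.
  - move=> t tT; rewrite g0//= /dpsi.
    have pt : 0 < psi t by case/andP: tT => t0 tT; rewrite psi_gt0// !ltW.
    have -> : - (2^-1 * ((psi t)^-1 * (2 * dot ('d F (v t) (dv t)) (F (v t))))) =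
        - dot ('d F (v t) (dv t)) (F (v t)) / psi t by field; rewrite gt_eqF.
    by rewrite ler_pdivlMr//; have := Hdecr t tT; rewrite -psiE; lra.
  - exact: ig.
move=> incr; rewrite /decay -ler_ln ?posrE ?mulr_gt0 ?expR_gt0 ?norm_gt0//.
rewrite lnM ?posrE ?expR_gt0 ?norm_gt0// expRK; lra.
Qed.
End Estimates.

(** * The global solution and its limit *)

Theorem theorem1 (R : realType) (H : completeNormedModType R)
  (dot : {dot H for idfun}) (Hnorm : induces_norm dot)
  (F : H -> H) (HF : forall u : H, differentiable F u)
  (u0 : H) (r : R) (r_gt0 : 0 < r)
  (Phi : R -> H -> H)
  (Phi_cont : continuous_Rplus_times (cball u0 r) Phi)
  (Phi_lip : lipschitz_in_space (cball u0 r) Phi)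
  (g1 g2 : R -> R)
  (g1_gt0 : forall t, 0 <= t -> 0 < g1 t)
  (g2_gt0 : forall t, 0 <= t -> 0 < g2 t)
  (g2_cont : {within `[0, +oo[, continuous g2})
  (g1_L1loc : L1loc_Rplus g1)
  (Hdecr : forall t u, 0 <= t -> cball u0 r u ->
     dot ('d F u (Phi t u)) (F u) <= - g1 t * `|F u| ^+ 2)
  (Hbound : forall t u, 0 <= t -> cball u0 r u ->
     `|Phi t u| <= g2 t * `|F u|)
  (g1_int : (\int[@lebesgue_measure R]_(t in `[0%R, +oo[) (g1 t)%:E = +oo)%E)
  (G := fun t : R => g2 t * decay g1 t)
  (G_L1 : (@lebesgue_measure R).-integrable `[0, +oo[ (EFin \o G))
  (G_le : `|F u0| * \int[@lebesgue_measure R]_(t in `[0, +oo[) G t <= r) :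
  exists u : R -> H,
    [/\ global_solution Phi u0 u,
        forall t, 0 <= t -> cball u0 r (u t) &
        exists y : H,
          [/\ u t @[t --> +oo] --> y,
              F y = 0,
              forall t, 0 <= t ->
                `|u t - y| <=
                  `|F u0| * \int[@lebesgue_measure R]_(x in `[t, +oo[) G x &
              forall t, 0 <= t -> `|F (u t)| <= `|F u0| * decay g1 t]].
Proof.
pose K := `|F u0|.
have K0 : 0 <= K by exact: normr_ge0.
pose Gam t : R := \int[@lebesgue_measure R]_(s in `[0, t]) G s.
have g1_ge0 t : 0 <= t -> 0 <= g1 t by move/g1_gt0/ltW.
have G_gt0 t : 0 <= t -> 0 < G t.
  by move=> t0; rewrite mulr_gt0 ?expR_gt0 ?g2_gt0.
have G_ge0 t : 0 <= t -> 0 <= G t by move/G_gt0/ltW.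
have G_L1loc : L1loc_Rplus G.
  by move=> T _; apply: integrableS G_L1 => //; exact: subset_itvl.
have cG t : 0 < t -> {for t, continuous G}.
  move=> t0; apply: continuousM.
    have /continuous_within_itvcyP[+ _] := g2_cont; apply.
    by rewrite in_itv/= t0.
  apply: (@continuous_comp _ _ _ (fun t => - _) expR); last exact: continuous_expR.
  exact/continuousN/cumul_continuous_at.
have DGam (t : R) : 0 < t -> is_derive t 1 Gam (G t).
  by move=> t0; apply: is_derive_cumul => //; exact: cG.
have Gam_homo : nondecreasing_fun Gam by exact: cumul_homo.
have Gam_le t : Gam t <= \int[@lebesgue_measure R]_(s in `[0, +oo[) G s.
  exact: cumul_le.
(* The integral over [[t, t + 1]] of the positive function [G] is missing. *)
have Gam_lt t : 0 <= t -> Gam t < \int[@lebesgue_measure R]_(s in `[0, +oo[) G s.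
  move=> t0; apply: lt_le_trans (Gam_le (t + 1)).
  have tt1 : t < t + 1 by rewrite ltrDl.
  have cGam : {within `[t, t + 1], continuous Gam}.
    apply: continuous_subspaceW (cumul_continuous G_L1loc (addr_ge0 t0 ler01)).
    by apply: subset_itvr; rewrite bnd_simp.
  have DGam' (s : R) : s \in `]t, (t + 1)[ -> is_derive s 1 Gam (G s).
    by rewrite in_itv/= => /andP[ts _]; apply: DGam; exact: le_lt_trans ts.
  have [s] := MVT tt1 DGam' cGam.
  rewrite in_itv/= addrAC subrr add0r mulr1 => /andP[ts _] GamE.
  by rewrite -subr_gt0 GamE G_gt0// (le_trans t0)// ltW.
pose Psi (t : R) (x : H) := Phi (Num.max t 0) (retract u0 r x).
have cPsi w : continuous w -> continuous (fun t => Psi t (w t)).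
  move=> cw; pose k (t : R) := (Num.max t 0, retract u0 r (w t)).
  have ck : continuous k.
    have cr : continuous (retract u0 r) by exact: retract_continuous.
    have cm : continuous (fun t : R => Num.max t 0).
      by move=> t; apply: continuous_max; [exact: cvg_id|exact: cvg_cst].
    by move=> t; exact: cvg_pair (cm t) (continuous_comp (cw t) (cr (w t))).
  have kB t : [set z : R * H | 0 <= z.1 /\ cball u0 r z.2] (k t).
    by split; [rewrite /= le_max lexx orbT|exact: retract_cball].
  exact: (comp_within_continuous ck kB Phi_cont).
have lipPsi T : exists L : R, forall t x y, `|t| <= T ->
    `|Psi t x - Psi t y| <= L * `|x - y|.
  have [T0|T0] := ltP T 0.
    by exists 0 => t x y tT; have := le_lt_trans tT T0; rewrite normr_lt0.
  have [L HL] := Phi_lip T T0; exists (`|L| * 2) => t x y tT.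
  have /HL/(_ (retract u0 r x, retract u0 r y)) : 0 <= Num.max t 0 <= T.
    by rewrite le_max lexx orbT/= ge_max T0 andbT (le_trans (ler_norm t)).
  move=> /(_ (conj (retract_cball _ r_gt0 x) (retract_cball _ r_gt0 y))) /=.
  move/le_trans; apply; rewrite -mulrA.
  rewrite (le_trans (ler_wpM2r (normr_ge0 _) (ler_norm L)))//.
  by rewrite ler_wpM2l// retract_lipschitz.
have [u [u0E Du]] := cauchy_problem Hnorm u0 cPsi lipPsi.
have cu : continuous u by move=> t; exact: is_derive_continuous (Du t).
have vel t : 0 <= t -> cball u0 r (u t) ->
    Psi t (u (Num.max t 0)) = Phi t (u t).
  by move=> t0 ut; rewrite /Psi (max_l t0) retract_id.
have F_le T : 0 <= T -> (forall t, 0 <= t < T -> cball u0 r (u t)) ->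
    `|F (u T)| <= K * decay g1 T.
  move=> T0 uB; rewrite /K -u0E.
  apply: (norm_decay Hnorm T0 HF Du) => [t /andP[t0 _]||t /andP[t0 tT]].
  - by rewrite g1_ge0// ltW.
  - exact: g1_L1loc.
  - have uBt : cball u0 r (u t) by apply: uB; rewrite ltW.
    by rewrite (vel _ (ltW t0) uBt); exact: Hdecr (ltW t0) uBt.
(* By [F_le] the speed [g2 t * `|F (u t)|] is at most [K * G t]. *)
have u_dist s T : 0 <= s <= T -> (forall t, 0 <= t < T -> cball u0 r (u t)) ->
    `|u T - u s| <= K * (Gam T - Gam s).
  move=> /andP[s0 sT] uB; rewrite mulrBr.
  apply: (mean_value_inequality (phi := fun t => K * Gam t) Hnorm sT
    (fun t _ => Du t) (dphi := fun t => K * G t)).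
  - move=> t /andP[st _]; apply: is_deriveZ; apply: DGam.
    exact: le_lt_trans st.
  - exact: continuous_subspaceT.
  - move=> t; apply: cvgM; first exact: cvg_cst.
    apply: continuous_subspaceW (cumul_continuous G_L1loc (le_trans s0 sT)) t.
    by apply: subset_itvr; rewrite bnd_simp.
  - move=> t /andP[st tT]; have t0 : 0 <= t by rewrite (le_trans s0)// ltW.
    have uBt : cball u0 r (u t) by apply: uB; rewrite t0.
    rewrite vel// (le_trans (Hbound _ _ t0 uBt))// /G mulrCA ler_wpM2l//.
      by rewrite ltW// g2_gt0.
    apply: F_le => // q /andP[q0 qt]; apply: uB; rewrite q0.
    exact: lt_trans tT.
(* The inequality is strict: either [K = 0] and the solution does not move, or
   [K * Gam T] is smaller than [K] times the full integral of [G]. *)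
have u_in t : 0 <= t -> cball u0 r (u t).
  move=> t0; apply/ltW; move: t t0.
  apply: (@lt_of_no_exit _ (fun t => `|u t - u0|)).
    by move=> t; apply: cvg_norm; apply: cvgB; [exact: cu|exact: cvg_cst].
  move=> T T0 before.
  have := u_dist 0 T; rewrite lexx T0 u0E => /(_ isT) Hd.
  apply: (le_lt_trans (Hd _)); first by move=> t /before/ltW.
  have -> : Gam 0 = 0 by rewrite /Gam set_itv1 Rintegral_set1.
  rewrite subr0.
  have [KE|KN0] := eqVneq K 0; first by rewrite KE mul0r.
  by rewrite (lt_le_trans _ G_le)// ltr_pM2l ?Gam_lt// lt_neqAle eq_sym KN0.
have {}F_le t : 0 <= t -> `|F (u t)| <= K * decay g1 t.
  by move=> t0; apply: F_le => // s /andP[s0 _]; exact: u_in.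
have {}u_dist s t : 0 <= s <= t -> `|u t - u s| <= K * (Gam t - Gam s).
  by move=> st; apply: u_dist => // q /andP[q0 _]; exact: u_in.
exists u; split=> //.
  split=> // t t0; apply: is_derive_half_line.
  by rewrite -vel//; exact: u_in.
pose L := sup (range Gam).
have Gam_cvg : Gam t @[t --> +oo] --> L.
  by apply: nondecreasing_cvgr => //; eexists => _ [t _ <-]; exact: Gam_le.
have Gam_leL t : Gam t <= L.
  by apply: (cvgr_to_ge Gam_cvg); near=> s; apply: Gam_homo; near: s;
    apply: nbhs_pinfty_ge; rewrite num_real.
have [y uy] : exists y : H, u t @[t --> +oo] --> y.
  apply/cvg_ex/cauchy_cvgP/cauchy_exP => e e0.
  have e'0 : 0 < e / (K + 1) by rewrite divr_gt0// ltr_wpDl.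
  have [t0 [t0_ge0 Gt0]] : exists t0, 0 <= t0 /\ L - e / (K + 1) < Gam t0.
    near (+oo : set_system R) => t0; exists t0; split.
      by near: t0; apply: nbhs_pinfty_ge; rewrite num_real.
    by near: t0; apply: (cvgr_gt _ Gam_cvg); rewrite gtrBl.
  exists (u t0); suff : \forall t \near +oo, ball (u t0) e (u t) by [].
  near=> t; rewrite -ball_normE /= distrC.
  have t0t : 0 <= t0 <= t.
    by rewrite t0_ge0/=; near: t; apply: nbhs_pinfty_ge; rewrite num_real.
  rewrite (le_lt_trans (u_dist _ _ t0t))//.
  have eE : e = (K + 1) * (e / (K + 1)) by field; rewrite gt_eqF// ltr_wpDl.
  rewrite [ltRHS]eE; have := Gam_leL t; move: Gt0 e'0; move: (e / _) => q; nra.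
exists y; split=> //.
- apply/eqP; rewrite -normr_eq0 eq_le normr_ge0 andbT.
  have Fu : `|F (u t)| @[t --> +oo] --> `|F y|.
    apply: cvg_norm; apply: (cvg_comp _ _ uy).
    exact: differentiable_continuous.
  have dec0 : K * decay g1 t @[t --> +oo] --> 0.
    rewrite -(mulr0 K); apply: cvgM; first exact: cvg_cst.
    exact: (cvg_comp _ _ (cumul_cvgy g1_ge0 g1_L1loc g1_int) (@cvgr_expR R)).
  apply: (ler_cvg_to Fu dec0); near=> t; apply: F_le.
  by near: t; apply: nbhs_pinfty_ge; rewrite num_real.
- move=> t t0.
  have uty : `|u t - u s| @[s --> +oo] --> `|u t - y|.
    by apply: cvg_norm; apply: cvgB => //; exact: cvg_cst.
  apply: (cvgr_to_le uty); near=> s.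
  have ts : t <= s by near: s; apply: nbhs_pinfty_ge; rewrite num_real.
  rewrite distrC (le_trans (u_dist t s _)) ?t0// ler_wpM2l//.
  have G_L1t : (@lebesgue_measure R).-integrable `]t, +oo[ (EFin \o G).
    by apply: integrableS G_L1 => //; apply: subset_itvr; rewrite bnd_simp.
  rewrite -Rintegral_itv_obnd_cbnd// -(Rintegral_itvB G_L1) ?bnd_simp//.
  by rewrite lerD2r.
Unshelve. all: by end_near. Qed.
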